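(* Let $A\subset\omega^\omega$ be closed. Then $A$ can be written uniquely as $A=P\cup C$ with $P$ superperfect, $C$ $\sigma$-bounded, and $P\cap C=\emptyset$.
   Context: $\omega^\omega$ is the Baire space. For $f,g\in\omega^\omega$, $f\leq g$ means $f(n)\leq g(n)$ for all $n<\omega$. A set $C\subset\omega^\omega$ is $\sigma$-bounded if there is a sequence $(f_i)_{i<\omega}$ in $\omega^\omega$ such that for every $f\in C$ there is $i<\omega$ with $f\leq f_i$. A tree on $\omega$ is a set $T$ of finite sequences of natural numbers closed under initial segments; $[T]$ is the set of $f\in\omega^\omega$ all of whose finite initial segments lie in $T$. A tree $T$ is superperfect if every $u\in T$ has an extension $v\in T$ (possibly $v=u$) such that $\{m<\omega : v\cdot(m)\in T\}$ is infinite, where $v\cdot(m)$ is the concatenation of $v$ with the one-term sequence $(m)$. A set $P\subset\omega^\omega$ is superperfect if $P=[T]$ for some superperfect tree $T$ on $\omega$. (In particular the empty set is superperfect.) *)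

(* Defs.v *)
From HB Require Import structures.
From mathcomp Require Import all_boot all_order all_algebra.
From mathcomp Require Import boolp classical_sets functions cardinality.
From mathcomp Require Import topology.

Set Implicit Arguments.
Unset Strict Implicit.
Unset Printing Implicit Defensive.

Local Open Scope classical_set_scope.

(* The topology on [nat] is the discrete one. *)
Definition baire_space : Type := prod_topology (fun _ : nat => nat).

HB.instance Definition _ := Pointed.on baire_space.
HB.instance Definition _ := Nbhs.on baire_space.
HB.instance Definition _ := Topological.on baire_space.

Definition baire_le (f g : baire_space) : Prop := forall n : nat, (f n <= g n)%N.

Definition sigma_bounded (C : set baire_space) : Prop :=
  exists F : nat -> baire_space, forall f, C f -> exists i, baire_le f (F i).

(* The empty set of sequences is a tree. *)
Definition is_tree (T : set (seq nat)) : Prop :=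
  forall u v : seq nat, prefix u v -> T v -> T u.

(* [mkseq f n] is the initial segment [:: f 0; ...; f (n - 1)]. *)
Definition branches (T : set (seq nat)) : set baire_space :=
  [set f : baire_space | forall n : nat, T (mkseq f n)].

Definition superperfect_tree (T : set (seq nat)) : Prop :=
  is_tree T /\
  forall u, T u ->
    exists v, [/\ T v, prefix u v & infinite_set [set m : nat | T (rcons v m)]].

Definition superperfect (P : set baire_space) : Prop :=
  exists T : set (seq nat), superperfect_tree T /\ P = branches T.

(* Main.v *)
Require Import Defs.
From mathcomp Require Import all_boot all_order all_algebra.
From mathcomp Require Import boolp classical_sets functions cardinality.
From mathcomp Require Import topology.

(** The decomposition is a Cantor-Bendixson analysis in which sigma-bounded sets
    play the role of countable ones.  Let S be the tree of the finite sequences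
    u such that the part of A extending u is not sigma-bounded; then
    P = branches S and C = A \ P.

    Since A is closed, P is contained in A.  The set C is sigma-bounded because
    each of its points has an initial segment outside S, and there are only
    countably many of these, each with a sigma-bounded part of A above it.  The
    tree S is superperfect: if no extension of u in S had infinitely many
    successors in S, then S would be finitely branching above u, so the part of
    P above u would be bounded by a single function ([bounded_branching]);
    together with C this would make the part of A above u sigma-bounded.

    Uniqueness rests on a diagonal argument
    ([superperfect_not_sigma_bounded]): above each of its nodes, a superperfect
    tree has a set of branches that is not sigma-bounded.  Hence in any
    decomposition A = P' + C', every initial segment of a point of P' is in S,
    so P' is contained in P; conversely, if f is in P but not in P', then some
    initial segment u of f has no extension in P', so the part of A above u is
    contained in C' and is sigma-bounded, contradicting that u is in S. *)

Local Open Scope classical_set_scope.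

Definition cone (A : set baire_space) (u : seq nat) : set baire_space :=
  [set f | A f /\ mkseq f (size u) = u].

Definition unbounded_nodes (A : set baire_space) : set (seq nat) :=
  [set u | ~ sigma_bounded (cone A u)].

Lemma take_mkseq (f : nat -> nat) m n : m <= n -> take m (mkseq f n) = mkseq f m.
Proof. by move=> mn; rewrite /mkseq -map_take take_iota (minn_idPl mn). Qed.

Lemma prefix_mkseq (f : nat -> nat) m n :
  m <= n -> prefix (mkseq f m) (mkseq f n).
Proof. by move=> mn; rewrite prefixE size_mkseq take_mkseq. Qed.

Lemma mkseq_prefix (f : nat -> nat) (u v : seq nat) :
  prefix u v -> mkseq f (size v) = v -> mkseq f (size u) = u.
Proof.
move=> uv fv; rewrite -(take_mkseq _ _ _ (size_prefix uv)) fv.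
by apply/eqP; rewrite -prefixE.
Qed.

(** Points of A that agree with f on longer and longer initial segments
    converge to f in the product topology. *)
Lemma closed_prefix (A : set baire_space) (f : baire_space) :
  closed A -> (forall n, exists2 g, A g & mkseq g n = mkseq f n) -> A f.
Proof.
move=> cA /(_ _)/cid2 g_.
pose g n : baire_space := sval (g_ n).
apply: (@closed_cvg _ _ \oo _ g A cA).
  by near=> n; rewrite /g; case: (g_ n).
apply/cvg_sup => i U [/= _ [[V /= oV <-] Vf]] /filterS; apply.
exists i.+1 => // n /= i_n; rewrite /g; case: (g_ n) => h /= _ hf.
suff -> : h i = f i by [].
by rewrite -(nth_mkseq 0 h i_n) hf nth_mkseq.
Unshelve. all: by end_near. Qed.

Lemma sigma_bounded_sub (B C : set baire_space) :
  B `<=` C -> sigma_bounded C -> sigma_bounded B.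
Proof. by move=> BC [F CF]; exists F => f /BC/CF. Qed.

(** The doubly indexed family of bounds is enumerated through the countability
    of I * nat. *)
Lemma sigma_bounded_bigcup (I : countType) (B : I -> set baire_space) :
  (forall i, sigma_bounded (B i)) -> sigma_bounded (\bigcup_i B i).
Proof.
move=> /choice[F BF].
exists (fun k => if unpickle k is Some (i, j) then F i j else fun=> 0).
move=> f [i _ /BF[j fF]].
by exists (pickle (i, j)); rewrite pickleK.
Qed.

Lemma sigma_boundedU (B C : set baire_space) :
  sigma_bounded B -> sigma_bounded C -> sigma_bounded (B `|` C).
Proof.
move=> sB sC; rewrite -bigcup2E.
by apply: sigma_bounded_bigcup => -[|[|n]] //=; exists (fun _ _ => 0).
Qed.

(** A weak form of compactness: the functions that select each value below a
    bound depending on the values before it have finitely many initial segments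
    of each length, so the bound can be maximised over these. *)
Lemma bounded_branching (h : seq nat -> nat) :
  sigma_bounded [set f | forall n, f n <= h (mkseq f n)].
Proof.
(* A finite list of all the possible initial segments of length n. *)
pose L n := iter n (fun s => [seq rcons v m | v <- s, m <- iota 0 (h v).+1])
  [:: [::]].
exists (fun _ n => \max_(v <- L n) h v) => f fh; exists 0 => n.
suff fL : mkseq f n \in L n.
  exact: leq_trans (fh n) (leq_bigmax_seq _ fL isT).
elim: n => [|n IHn]; first by rewrite inE.
rewrite mkseqS; apply/allpairsPdep; exists (mkseq f n), (f n).
by rewrite IHn mem_iota add0n ltnS fh.
Qed.

Lemma infinite_set_unbounded (M : set nat) k :
  infinite_set M -> exists2 m, M m & k < m.
Proof.
move=> iM; apply: contrapT => nM; apply: iM.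
apply: (@sub_finite_set _ _ `I_k.+1); last exact: finite_II.
by move=> m Mm; rewrite /= ltnNge; apply/negP => km; apply: nM; exists m.
Qed.

Lemma finite_set_bounded (M : set nat) :
  ~ infinite_set M -> exists k, forall m, M m -> m <= k.
Proof.
move=> nM; apply: contrapT => nb; apply: nM => -/finite_seqP[s Ms].
apply: nb; exists (\max_(m <- s) m) => m; rewrite Ms => /= ms.
exact: (leq_bigmax_seq _ ms isT).
Qed.

(** Diagonalisation: climbing from u through nodes with infinitely many
    successors, the k-th step chooses a successor whose last value exceeds that
    of the k-th function of a given sequence, so the resulting branch is below
    none of them. *)
Lemma superperfect_not_sigma_bounded (T : set (seq nat)) u :
  superperfect_tree T -> T u -> ~ sigma_bounded (cone (branches T) u).
Proof.
move=> [treeT splitT] Tu [F bF].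
have step k v : exists w, T v ->
    [/\ T w, prefix v w, size v < size w &
        F k (size w).-1 < nth 0 w (size w).-1].
  have [Tv|nTv] := pselect (T v); last by exists [::].
  have [w [Tw vw /(infinite_set_unbounded _ (F k (size w)))[m Tm Fm]]] := splitT _ Tv.
  exists (rcons w m) => _; split=> //.
  - by apply: prefix_trans vw _; rewrite prefix_rcons.
  - by rewrite size_rcons ltnS; exact: size_prefix.
  - by rewrite size_rcons /= nth_rcons ltnn eqxx.
(* The index and the node are paired so that choice gives a single map. *)
have /choice[next nextP] : forall kv : nat * seq nat, exists w, T kv.2 ->
    [/\ T w, prefix kv.2 w, size kv.2 < size w &
        F kv.1 (size w).-1 < nth 0 w (size w).-1].
  by move=> [k v]; exact: step.
pose U := fix U k := if k is j.+1 then next (j, U j) else u.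
have TU k : T (U k).
  by elim: k => [//|k Tk]; have [TUk _ _ _] := nextP (k, U k) Tk; exact: TUk.
have UP k : [/\ prefix (U k) (U k.+1), size (U k) < size (U k.+1) &
    F k (size (U k.+1)).-1 < nth 0 (U k.+1) (size (U k.+1)).-1].
  by have [_ pU sU FU] := nextP (k, U k) (TU k); split.
have UU i j : i <= j -> prefix (U i) (U j).
  move=> /subnKC <-; elim: (j - i) => [|d IHd]; first by rewrite addn0 prefix_refl.
  by rewrite addnS; apply: prefix_trans IHd _; have [] := UP (i + d).
have sizeU k : k <= size (U k).
  by elim: k => // k IHk; apply: leq_ltn_trans IHk _; have [] := UP k.
(* The node U n.+1 has length at least n.+1, so the default 0 is never read. *)
pose f : baire_space := fun n => nth 0 (U n.+1) n.
have fU k n : n < size (U k) -> f n = nth 0 (U k) n.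
  move=> nk; have [/UU|/ltnW/UU] := leqP k n.+1 => /prefixP[w e]; rewrite /f.
    by rewrite e nth_cat nk.
  by rewrite e nth_cat sizeU.
have mkU k : mkseq f (size (U k)) = U k.
  apply: (@eq_from_nth _ 0); rewrite size_mkseq// => n nk.
  by rewrite nth_mkseq//; exact: fU.
have [|k fF] := bF f.
  split; last exact: (mkU 0).
  move=> n; apply: treeT (TU n); rewrite -(mkU n).
  exact: prefix_mkseq.
have [_ lt_size] := UP k.
rewrite -(fU k.+1); first by rewrite ltnNge fF.
by rewrite prednK//; exact: leq_ltn_trans lt_size.
Qed.

Lemma unbounded_nodes_tree A : is_tree (unbounded_nodes A).
Proof.
move=> u v uv Sv su; apply: Sv; apply: sigma_bounded_sub su => f [Af fv].
by split=> //; exact: mkseq_prefix fv.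
Qed.

(** A node in the tree has extensions in A, since the empty set is
    sigma-bounded; closedness does the rest. *)
Lemma branches_unbounded_nodes_sub (A : set baire_space) :
  closed A -> branches (unbounded_nodes A) `<=` A.
Proof.
move=> cA f Sf; apply: closed_prefix cA _ => n.
apply: contrapT => nA; apply: (Sf n); exists (fun _ _ => 0) => g [Ag].
by rewrite size_mkseq => gf; case: nA; exists g.
Qed.

(** Each point of this set lies in one of the sigma-bounded cones of A, and there
    are only countably many cones. *)
Lemma sigma_bounded_kernel_compl A :
  sigma_bounded (A `\` branches (unbounded_nodes A)).
Proof.
(* Cones that are not sigma-bounded are replaced by the empty set, so that all
   finite sequences can serve as indices. *)
pose B u := [set f | cone A u f /\ sigma_bounded (cone A u)].
apply: (@sigma_bounded_sub _ (\bigcup_u B u)).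
  move=> f [Af /existsNP[n /contrapT sn]]; exists (mkseq f n) => //.
  by split=> //; split=> //; rewrite size_mkseq.
apply: sigma_bounded_bigcup => u.
have [su|nsu] := pselect (sigma_bounded (cone A u)).
  by apply: sigma_bounded_sub su => f [].
by exists (fun _ _ => 0) => f [_ /nsu].
Qed.

(** If the tree were finitely branching above a node u, its branches through u
    would be bounded by [bounded_branching], and the rest of the cone above u is
    sigma-bounded by [sigma_bounded_kernel_compl]. *)
Lemma unbounded_nodes_superperfect A : superperfect_tree (unbounded_nodes A).
Proof.
split; first exact: unbounded_nodes_tree.
set S := unbounded_nodes A => u Su; apply: contrapT => nsplit; apply: (Su).
have finbr v : exists k, S v -> prefix u v -> forall m, S (rcons v m) -> m <= k.
  have [[Sv uv]|nv] := pselect (S v /\ prefix u v); last first.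
    by exists 0 => Sv uv; case: nv.
  have [k kP] : exists k, forall m, S (rcons v m) -> m <= k.
    by apply: finite_set_bounded => iv; apply: nsplit; exists v.
  by exists k.
have [h hP] := choice finbr.
(* Below the length of u the branches through u have the values of u; this
   bound makes the branching control start at the root. *)
pose h' v := if size v < size u then nth 0 u (size v) else h v.
apply: (@sigma_bounded_sub _ ((A `\` branches S) `|`
                              [set f | forall n, f n <= h' (mkseq f n)])).
  move=> f [Af fu]; have [Sf|nSf] := pselect (branches S f); last by left.
  right=> n /=; rewrite /h' size_mkseq; case: ltnP => [nu|un].
    by rewrite -[in X in _ <= X]fu nth_mkseq.
  apply: hP (Sf n) _ _ _; first by rewrite -fu prefix_mkseq.
  by rewrite -mkseqS; exact: Sf.
by apply: sigma_boundedU (bounded_branching h'); exact: sigma_bounded_kernel_compl.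
Qed.

Theorem mainTheorem4 (A : set baire_space) (hA : closed A) :
  exists! PC : set baire_space * set baire_space,
    [/\ A = PC.1 `|` PC.2,
        superperfect PC.1,
        sigma_bounded PC.2 &
        PC.1 `&` PC.2 = set0].
Proof.
set S := unbounded_nodes A.
have PA : branches S `<=` A by exact: branches_unbounded_nodes_sub.
exists (branches S, A `\` branches S); split=> [|[P C]] /=.
  split.
  - by rewrite setDUK.
  - by exists S; split=> //; exact: unbounded_nodes_superperfect.
  - exact: sigma_bounded_kernel_compl.
  - by rewrite setDIK.
move=> [AE [T [spT PT]] sC PC0].
have PE : branches S = P.
  rewrite eqEsubset; split=> f.
    move=> Sf; rewrite PT; apply: contrapT => /existsNP[n nTn].
    apply: (Sf n); apply: sigma_bounded_sub sC => g [].
    rewrite AE size_mkseq => -[|//].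
    by rewrite PT => /(_ n) + gf; rewrite gf.
  rewrite PT => Tf n sn.
  apply: (superperfect_not_sigma_bounded _ _ spT (Tf n)).
  by apply: sigma_bounded_sub sn => g [Tg ?]; split=> //; rewrite AE PT; left.
congr pair; first exact: PE.
rewrite PE AE setDUl setDv set0U; apply/setDidPl.
by rewrite setIC.
Qed.
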